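(* Let $p$ be a prime, let $A$ be a countably infinite elementary abelian $p$-group, and let $\mathcal{T}_{Bohr}$ be the Bohr topology on $A$. Let $\mathcal{U}$ be the ring topology on $\mathrm{End} A$ associated with $\mathcal{T}_{Bohr}$. Then the supremum $\mathcal{U}\vee\mathcal{T}_{fin}$ is a nonmetrizable admissible ring topology on $\mathrm{End} A$.
   Context: An elementary $p$-group is an abelian group $A$ with $pA=0$. The Bohr topology $\mathcal{T}_{Bohr}$ on an abelian group $A$ is the largest precompact group topology on $A$; it is Hausdorff. The ring topology $\mathcal{U}$ on $\mathrm{End} A$ associated with $\mathcal{T}_{Bohr}$ is the one having as a fundamental system of neighborhoods of zero the sets $P(V)=\{\alpha\in \mathrm{End} A\mid \alpha(A)\subset V\}$, where $V$ runs over all neighborhoods of zero of $(A,\mathcal{T}_{Bohr})$. The finite topology $\mathcal{T}_{fin}$ on $\mathrm{End} A$ has as a fundamental system of neighborhoods of zero the sets $T(K)=\{\alpha\in \mathrm{End} A\mid \alpha K=0\}$, $K$ running over all finite subsets of $A$. A ring topology $\mathcal{T}$ on $\mathrm{End} A$ is called admissible if $\mathcal{T}\geq\mathcal{T}_{fin}$, i.e. every $\mathcal{T}_{fin}$-open set is $\mathcal{T}$-open. *)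

(* Defs.v *)
From HB Require Import structures.
From mathcomp Require Import all_boot all_order all_algebra.
From mathcomp Require Import all_classical all_reals all_analysis.

Set Implicit Arguments.
Unset Strict Implicit.
Unset Printing Implicit Defensive.

Import GRing.Theory Num.Theory.

Local Open Scope classical_set_scope.
Local Open Scope ring_scope.

(* Endomorphism ring of an abelian group; the product is composition. *)
Definition End (A : zmodType) : Type := {additive A -> A}.

Section EndOperations.
Context {A : zmodType}.
Implicit Types f g : End A.

Definition End_zero : End A := (\0 : A -> A).
Definition End_opp f : End A := (\- (f : {additive A -> A}) : A -> A).
Definition End_add f g : End A :=
  ((f : {additive A -> A}) \+ (g : {additive A -> A}) : A -> A).
Definition End_one : End A := (idfun : A -> A).
Definition End_mul f g : End A :=
  ((f : {additive A -> A}) \o (g : {additive A -> A}) : A -> A).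

End EndOperations.

Definition End_fun (A : zmodType) (f : End A) : A -> A :=
  fun x => (f : {additive A -> A}) x.
Coercion End_fun : End >-> Funclass.

Section EndRing.
Context {A : zmodType}.
Implicit Types f g h : End A.

Lemma End_ext f g : f =1 g -> f = g.
Proof.
move=> /funext; case: f g => [f [[fA]]] [g [[gA]]]; rewrite /End_fun /= => efg.
by case: g / efg gA => gA; rewrite (Prop_irrelevance fA gA).
Qed.

HB.instance Definition _ := gen_eqMixin (End A).
HB.instance Definition _ := gen_choiceMixin (End A).

Let addA : associative (@End_add A).
Proof. by move=> f g h; apply: End_ext => x; exact: addrA. Qed.
Let addC : commutative (@End_add A).
Proof. by move=> f g; apply: End_ext => x; exact: addrC. Qed.
Let add0 : left_id (@End_zero A) (@End_add A).
Proof. by move=> f; apply: End_ext => x; exact: add0r. Qed.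
Let addN : left_inverse (@End_zero A) (@End_opp A) (@End_add A).
Proof. by move=> f; apply: End_ext => x; exact: addNr. Qed.

HB.instance Definition _ := GRing.isZmodule.Build (End A) addA addC add0 addN.

Let mulA : associative (@End_mul A).
Proof. by move=> f g h; apply: End_ext. Qed.
Let mul1 : left_id (@End_one A) (@End_mul A).
Proof. by move=> f; apply: End_ext. Qed.
Let mulr1 : right_id (@End_one A) (@End_mul A).
Proof. by move=> f; apply: End_ext. Qed.
Let mulDl : left_distributive (@End_mul A) (@GRing.add (End A)).
Proof. by move=> f g h; apply: End_ext. Qed.
Let mulDr : right_distributive (@End_mul A) (@GRing.add (End A)).
Proof. by move=> f g h; apply: End_ext => x; exact: (raddfD (f : {additive A -> A})). Qed.

HB.instance Definition _ :=
  GRing.Zmodule_isPzRing.Build (End A) mulA mul1 mulr1 mulDl mulDr.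

End EndRing.

Section EndRingTheory.
Context {A : zmodType}.
Implicit Types f g : End A.

Lemma EndD f g x : End_fun (f + g) x = f x + g x. Proof. by []. Qed.
Lemma EndM f g x : End_fun (f * g) x = f (g x). Proof. by []. Qed.
Lemma End0 x : End_fun (0 : End A) x = 0. Proof. by []. Qed.

End EndRingTheory.

(* Several topologies on one set X are handled as terms of type               *)
(* [Topological X], the class of topological structures with carrier X;       *)
(* [tspace t] is the corresponding topological space.                         *)
Definition tspace (X : Type) (t : Topological X) : topologicalType :=
  Topological.Pack t.

Definition coarser (X : Type) (s t : Topological X) : Prop :=
  @open (tspace s) `<=` @open (tspace t).

Definition topology_join (X : choiceType) (s t : Topological X) :
    Topological X :=
  Topological.on (sup_topology (fun b : bool => if b then s else t)).

Definition metrizable (R : realType) (X : Type) (t : Topological X) : Prop :=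
  exists d : Metric R X, @open (Metric.Pack d) = @open (tspace t).

Definition group_topology (A : zmodType) (t : Topological A) : Prop :=
  continuous (fun z : tspace t * tspace t => (z.1 : A) + z.2 : tspace t) /\
  continuous (fun x : tspace t => - (x : A) : tspace t).

Definition ring_topology (X : pzRingType) (t : Topological X) : Prop :=
  group_topology t /\
  continuous (fun z : tspace t * tspace t => (z.1 : X) * z.2 : tspace t).

(* Not [compact.precompact]: here precompact means totally bounded, i.e.      *)
(* finitely many translates of any neighbourhood of zero cover the group.     *)
Definition precompact_topology (A : zmodType) (t : Topological A) : Prop :=
  forall V : set A, nbhs (0 : tspace t) V ->
    exists2 F : set A, finite_set F & forall x, exists2 a, F a & V (x - a).

Definition Bohr_topology (A : zmodType) (t : Topological A) : Prop :=
  [/\ group_topology t, precompact_topology t &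
      forall s : Topological A,
        group_topology s -> precompact_topology s -> coarser s t].

Section BohrExistence.
Context {A : zmodType}.

Let precompact_group := {t : Topological A |
  group_topology t /\ precompact_topology t}.
Let S := sup_topology (fun i : precompact_group => projT1 i).

Let nbhs_sup (i : precompact_group) (x : A) :
  nbhs (x : tspace (projT1 i)) `<=` nbhs (x : S).
Proof.
have /cvg_sup/(_ i) : nbhs (x : S) --> (x : S) by exact: cvg_id.
exact.
Qed.

Let nbhs_sup_pair (i : precompact_group) (x y : A) :
  nbhs ((x, y) : tspace (projT1 i) * tspace (projT1 i)) `<=`
  nbhs ((x, y) : S * S).
Proof.
move=> W [[U V] [/= nU nV] UVW].
by exists (U, V) => //; split; exact: (@nbhs_sup i).
Qed.

(* V contains the differences of elements in the same block of some finite    *)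
(* partition of A, the fibers of c.                                           *)
Let fat (V : set A) := exists (K : choiceType) (c : A -> K),
  finite_set (range c) /\ forall x y, c x = c y -> V (x - y).

Let fat_filter : Filter fat.
Proof.
split.
- exists A, (fun=> 0); split => //.
  by apply: (@sub_finite_set _ _ [set 0]) => // _ [x _ <-].
- move=> U V [K [c [fc cU]]] [L [d [fd dV]]].
  exists (K * L)%type, (fun x => (c x, d x)); split.
    apply: sub_finite_set (finite_setX fc fd) => _ [x _ <-].
    by split; exists x.
  by move=> x y [cxy dxy]; split; [exact: cU|exact: dV].
- move=> U V UV [K [c [fc cU]]]; exists K, c; split=> // x y /cU; exact: UV.
Qed.

Let nbhs0_fat (i : precompact_group) : nbhs (0 : tspace (projT1 i)) `<=` fat.
Proof.
case: i => t /= [[addc oppc] tp] V nV.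
have /= := addc (0, 0) V; rewrite addr0 => /(_ nV)[[U1 U2] [/= n1 n2] U12].
have := oppc 0 U2; rewrite oppr0 => /(_ n2) nU2.
have [F fF FU] := tp _ (filterI n1 nU2).
have /choice[c Hc] : forall x, exists a, F a /\ (U1 `&` -%R @^-1` U2) (x - a).
  by move=> x; have [a] := FU x; exists a.
exists A, c; split.
  by apply: sub_finite_set fF => _ [x _ <-]; exact: (Hc x).1.
move=> x y cxy; have [_ [Ux _]] := Hc x; have [_ [_ Uy]] := Hc y.
have -> : x - y = (x - c x) + - (y - c y) by rewrite cxy opprB addrA subrK.
exact: (U12 (x - c x, - (y - c y))).
Qed.

Lemma Bohr_topology_exists : exists t : Topological A, Bohr_topology t.
Proof.
exists (Topological.on S); split.
- split.
  + move=> [x y]; apply/cvg_sup => i; have [[addc _] _] := projT2 i.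
    by apply: cvg_trans (addc (x, y)) => W /= /nbhs_sup_pair.
  + move=> x; have Fx : Filter (-%R @ nbhs (x : S)) by exact: fmap_filter.
    apply/(cvg_sup _ _ Fx) => i; have [[_ oppc] _] := projT2 i.
    by apply: cvg_trans (oppc x) => W /= /nbhs_sup.
- move=> V nV.
  have /(_ V nV)[K [c [fc cV]]] : nbhs (0 : S) `<=` fat.
    exact/(cvg_sup _ _ fat_filter)/nbhs0_fat.
  exists ((fun k => xget 0 [set x | c x = k]) @` range c).
    exact: finite_image.
  move=> x; exists (xget 0 [set y | c y = c x]); first by exists (c x).
  have /= cxget : [set y | c y = c x] (xget 0 [set y | c y = c x]).
    exact: (@xgetPex _ 0 [set y | c y = c x] (ex_intro _ x erefl)).
  by apply: cV; rewrite cxget.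
- move=> s sg sp U; rewrite !openE => oU x /oU nU.
  pose i : precompact_group := exist _ s (conj sg sp).
  exact: (@nbhs_sup i x U nU).
Qed.

End BohrExistence.

(* The translation-invariant topology attached to a filter F at zero: W is    *)
(* open iff W - a belongs to F for all a in W. F is the neighbourhood filter  *)
(* of zero under the conditions of [shift_topology_nbhs0].                    *)
Definition shift_space (X : zmodType) (F : set_system X) (FF : Filter F) :
  Type := X.

Section ShiftSpace.
Context {X : zmodType} {F : set_system X} (FF : Filter F).

Definition shift_open : set_system X :=
  [set W | forall a, W a -> F [set h | W (h + a)]].

Let openT : shift_open setT.
Proof. by move=> a _; exact: filterT. Qed.

Let openI U V : shift_open U -> shift_open V -> shift_open (U `&` V).
Proof. by move=> oU oV a [/oU Ua /oV Va]; exact: filterI. Qed.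

Let open_bigcup (I : Type) (f : I -> set X) :
  (forall i, shift_open (f i)) -> shift_open (\bigcup_i f i).
Proof. by move=> fo a [i _ /fo]; apply: filterS => h; exists i. Qed.

HB.instance Definition _ := Choice.on (shift_space FF).
HB.instance Definition _ :=
  isOpenTopological.Build (shift_space FF) openT openI open_bigcup.

Definition shift_topology : Topological X := Topological.on (shift_space FF).

Lemma shift_topology_nbhs0 : (forall W, F W -> W 0) ->
  (forall W, F W -> exists2 V, F V & forall x y, V x -> V y -> W (x + y)) ->
  nbhs (0 : tspace shift_topology) = F.
Proof.
move=> F0 FD; apply/seteqP; split=> W.
  rewrite nbhsE => -[U [oU U0] UW].
  by apply: filterS (oU _ U0) => h /=; rewrite addr0; exact: UW.
move=> FW; rewrite nbhsE; exists [set a | F [set h | W (h + a)]]; last first.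
  by move=> a /F0 /=; rewrite add0r.
split; last by apply: filterS FW => h /=; rewrite addr0.
move=> a /FD[V FV VW]; apply: filterS (FV) => h Vh.
by apply: filterS FV => k Vk /=; rewrite addrA; exact: VW.
Qed.

End ShiftSpace.

Section EndTopologies.
Context {A : zmodType}.

Definition End_into (V : set A) : set (End A) := [set f : End A | range f `<=` V].

Definition End_kill (K : set A) : set (End A) :=
  [set f : End A | forall x, K x -> f x = 0].

Lemma End_into_filter (t : Topological A) :
  Filter (filter_from (nbhs (0 : tspace t)) End_into).
Proof.
apply: filter_from_filter; first by exists setT; exact: filterT.
move=> U V nU nV; exists (U `&` V); first exact: filterI.
by move=> f fUV; split=> x /fUV[].
Qed.

Lemma End_kill_filter : Filter (filter_from finite_set End_kill).
Proof.
apply: filter_from_filter; first by exists set0; exact: finite_set0.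
move=> K L fK fL; exists (K `|` L); first by rewrite finite_setU.
by move=> f fKL; split=> x ?; apply: fKL; [left|right].
Qed.

Definition associated_topology (t : Topological A) : Topological (End A) :=
  shift_topology (End_into_filter t).

Definition finite_topology : Topological (End A) :=
  shift_topology End_kill_filter.

Lemma associated_topology_nbhs0 (t : Topological A) : group_topology t ->
  nbhs (0 : tspace (associated_topology t)) =
  filter_from (nbhs (0 : tspace t)) End_into.
Proof.
move=> [addc _]; apply: shift_topology_nbhs0 => W [V nV VW].
  by apply: VW => _ [x _ <-]; rewrite End0; exact: (@nbhs_singleton (tspace t)).
have /= := addc (0, 0) V; rewrite add0r => /(_ nV)[[U1 U2] [/= n1 n2] U12].
exists (End_into (U1 `&` U2)).
  by exists (U1 `&` U2) => //; exact: filterI.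
move=> f g fU gU; apply: VW => _ [x _ <-]; rewrite EndD.
apply: (U12 (f x, g x)); split => /=.
  by have [] : (U1 `&` U2) (f x) by apply: fU; exists x.
by have [] : (U1 `&` U2) (g x) by apply: gU; exists x.
Qed.

Lemma finite_topology_nbhs0 :
  nbhs (0 : tspace finite_topology) = filter_from finite_set End_kill.
Proof.
apply: shift_topology_nbhs0 => W [K fK KW]; first exact: KW.
exists (End_kill K); first by exists K.
by move=> f g f0 g0; apply: KW => x Kx; rewrite EndD f0// g0// addr0.
Qed.

Definition admissible (t : Topological (End A)) : Prop :=
  ring_topology t /\ coarser finite_topology t.

End EndTopologies.
Arguments finite_topology A : clear implicits.

(* Main.v *)
Require Import Defs.
From HB Require Import structures.
From mathcomp Require Import all_boot all_order all_algebra.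
From mathcomp Require Import all_classical all_reals all_analysis.

(** Both topologies are given by a filter of neighbourhoods of zero, so
    continuity of the ring operations reduces to conditions on that filter. For
    the topology of uniform convergence associated with the Bohr topology, the
    one condition with content is that left multiplication by an endomorphism g
    be continuous, which amounts to the Bohr-continuity of g. This is automatic
    by maximality: the preimage under g of a precompact group topology is again
    a precompact group topology, hence coarser than the Bohr topology
    ([Bohr_topology_continuous]). A supremum of two ring topologies is a ring
    topology, and it refines both.

    Metrizability fails already at zero, for lack of a countable base of
    neighbourhoods. Each neighbourhood of zero contains the endomorphisms that
    map into some Bohr neighbourhood V and kill some finite set K. As A is
    infinite of prime exponent, some e lies outside the finite subgroup
    spanned by K, and for every a there is an endomorphism that kills K, sends
    e to a and takes only multiples of a as values
    ([End_transitive_modulo_finite]). It belongs to the given neighbourhood as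
    soon as all multiples of a lie in V. A countable base for the supremum
    would thus yield countably many Bohr neighbourhoods W_n of zero (the a
    whose multiples lie in V_n) such that every Bohr neighbourhood contains
    some W_n.

    There is no such sequence ([Bohr_topology_no_countable_base]). The kernel
    of any homomorphism from A to the field with p elements is a Bohr
    neighbourhood of zero. Every W_n is infinite, because finitely many of its
    translates cover A, so one can pick a_n in W_n, each outside the finite
    subgroup spanned by a fixed nonzero e and the earlier choices; then some
    homomorphism takes the value 1 at every a_n, and its kernel contains no
    W_n. *)

Set Implicit Arguments.
Unset Strict Implicit.
Unset Printing Implicit Defensive.

Import Order.TTheory GRing.Theory Num.Theory.

Local Open Scope classical_set_scope.
Local Open Scope ring_scope.

(** * Topologies given by a filter of neighbourhoods of zero *)

Section ShiftTopology.
Context {X : zmodType} {F : set_system X} (FF : Filter F).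
Hypothesis F0 : forall W, F W -> W 0.
Hypothesis FD : forall W, F W ->
  exists2 V, F V & forall x y, V x -> V y -> W (x + y).

(** The translation-invariant topology is defined through its open sets; the
    interior of W is recovered as the set of b at which the translate W - b
    belongs to F, and halving neighbourhoods makes that set open. *)
Lemma shift_topology_nbhs (a : X) (W : set X) :
  nbhs (a : tspace (shift_topology FF)) W <-> F [set h | W (h + a)].
Proof.
split.
  rewrite nbhsE => -[U [oU Ua] UW].
  by apply: filterS (oU _ Ua) => h; exact: UW.
move=> FW; rewrite nbhsE; exists [set b | F [set h | W (h + b)]]; last first.
  by move=> b /F0 /=; rewrite add0r.
split; last exact: FW.
move=> b /FD[V FV VW]; apply: filterS (FV) => h Vh.
by apply: filterS FV => k Vk /=; rewrite addrA; exact: VW.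
Qed.

Hypothesis FN : forall W, F W -> F [set h | W (- h)].

Lemma shift_topology_group : group_topology (shift_topology FF).
Proof.
split.
- move=> [a b] W /= /shift_topology_nbhs /FD[V FV VW].
  exists ([set x | V (x - a)], [set x | V (x - b)]).
    split; apply/shift_topology_nbhs; apply: filterS FV => h /=.
      by rewrite addrK.
    by rewrite addrK.
  move=> [x y] [/= Vx Vy]; move: (VW _ _ Vx Vy).
  by rewrite /= (addrACA x) -opprD subrK.
- move=> a W /= /shift_topology_nbhs /FN FW; apply/shift_topology_nbhs.
  by apply: filterS FW => h /=; rewrite opprD.
Qed.

End ShiftTopology.

Section ShiftRingTopology.
Context {X : pzRingType} {F : set_system X} (FF : Filter F).
Hypothesis F0 : forall W, F W -> W 0.
Hypothesis FD : forall W, F W ->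
  exists2 V, F V & forall x y, V x -> V y -> W (x + y).
Hypothesis FN : forall W, F W -> F [set h | W (- h)].
Hypothesis FM : forall W, F W ->
  exists2 V, F V & forall x y, V x -> V y -> W (x * y).
Hypothesis FMl : forall a W, F W -> F [set h | W (a * h)].
Hypothesis FMr : forall a W, F W -> F [set h | W (h * a)].

(** With x = a + h and y = b + k, the product xy differs from ab by
    hk + hb + ak; the last two conditions handle hb and ak. *)
Lemma shift_topology_ring : ring_topology (shift_topology FF).
Proof.
split; first exact: shift_topology_group.
move=> [a b] W /= /(shift_topology_nbhs FF F0 FD) /FD[V FV VW].
have [V1 FV1 V1V] := FD FV; have [V2 FV2 V2V] := FM FV.
exists ([set x | (V2 `&` [set h | V1 (h * b)]) (x - a)],
        [set y | (V2 `&` [set h | V1 (a * h)]) (y - b)]).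
  split; apply/(shift_topology_nbhs FF F0 FD).
    by apply: filterS (filterI FV2 (FMr b FV1)) => h /=; rewrite addrK.
  by apply: filterS (filterI FV2 (FMl a FV1)) => h /=; rewrite addrK.
move=> [x y] [/= [Vx Vxb] [Vy Vay]].
suff -> /= : x * y = (x - a) * (y - b) + ((x - a) * b + a * (y - b)) + a * b.
  exact: (VW _ _ (V2V _ _ Vx Vy) (V1V _ _ Vxb Vay)).
by rewrite !addrA -mulrDr subrK -addrA -mulrDr subrK -mulrDl subrK.
Qed.

End ShiftRingTopology.

(** * Ring topologies on the endomorphism ring *)

Section EndRingTopologies.
Context {A : zmodType}.

(** Left multiplication preserves each basic neighbourhood of zero, while right
    multiplication by g replaces the finite set K by its image g(K). *)
Lemma finite_topology_ring : ring_topology (finite_topology A).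
Proof.
apply: shift_topology_ring =>
  [W [K fK KW]|W [K fK KW]|W [K fK KW]|W [K fK KW]|
   g W [K fK KW]|g W [K fK KW]].
- exact: KW.
- exists (End_kill K); first by exists K.
  by move=> f g f0 g0; apply: KW => x Kx; rewrite EndD f0// g0// addr0.
- exists K => // f f0; apply: KW => x Kx.
  by rewrite -[LHS]/(- (f x)) f0// oppr0.
- exists (End_kill K); first by exists K.
  move=> f g f0 g0; apply: KW => x Kx; rewrite EndM g0//.
  exact: (raddf0 (f : {additive A -> A})).
- exists K => // f f0; apply: KW => x Kx; rewrite EndM f0//.
  exact: (raddf0 (g : {additive A -> A})).
- exists (End_fun g @` K); first exact: finite_image.
  by move=> f f0; apply: KW => x Kx; rewrite EndM f0//; exists x.
Qed.

(** Here right multiplication preserves each basic neighbourhood of zero; left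
    multiplication by g replaces V by its preimage under g, whence the
    continuity hypothesis. *)
Lemma associated_topology_ring (t : Topological A) : group_topology t ->
  (forall f : End A, continuous (f : tspace t -> tspace t)) ->
  ring_topology (associated_topology t).
Proof.
move=> [addc oppc] endc.
have split2 V : nbhs (0 : tspace t) V ->
    exists2 U, nbhs (0 : tspace t) U & forall x y, U x -> U y -> V (x + y).
  move=> nV; have /= := addc (0, 0) V; rewrite add0r => /(_ nV).
  move=> -[[U1 U2] [/= n1 n2] U12]; exists (U1 `&` U2); first exact: filterI.
  by move=> x y [U1x _] [_ U2y]; exact: (U12 (x, y)).
apply: shift_topology_ring =>
  [W [V nV VW]|W [V nV VW]|W [V nV VW]|W [V nV VW]|
   g W [V nV VW]|g W [V nV VW]].
- by apply: VW => _ [x _ <-]; rewrite End0; exact: (@nbhs_singleton (tspace t)).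
- have [U nU UV] := split2 _ nV; exists (End_into U); first by exists U.
  move=> f g fU gU; apply: VW => _ [x _ <-].
  by apply: UV; [apply: fU|apply: gU]; exists x.
- exists (-%R @^-1` V); first by have := oppc 0 V; rewrite oppr0; apply.
  by move=> f fV; apply: VW => _ [x _ <-]; apply: (fV (f x)); exists x.
- exists (End_into V); first by exists V.
  move=> f g fV gV; apply: VW => _ [x _ <-].
  by rewrite EndM; apply: fV; exists (g x).
- exists (End_fun g @^-1` V).
    by apply: (endc g 0); rewrite [X in nbhs X](raddf0 (g : {additive A -> A})).
  move=> f fV; apply: VW => _ [x _ <-].
  by rewrite EndM; apply: (fV (f x)); exists x.
- exists V => // f fV; apply: VW => _ [x _ <-].
  by rewrite EndM; apply: fV; exists (g x).
Qed.

End EndRingTopologies.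

(** * Supremum of two topologies *)

Section Join.
Context {X : choiceType} (s t : Topological X).

Lemma topology_join_cvg (F : set_system X) (x : X) : Filter F ->
  F --> (x : tspace (topology_join s t)) <->
  F --> (x : tspace s) /\ F --> (x : tspace t).
Proof.
move=> FF; split=> [/(cvg_sup (fun b : bool => if b then s else t)) Fx|[Fs Ft]].
  by split; [exact: (Fx true)|exact: (Fx false)].
by apply/(cvg_sup (fun b : bool => if b then s else t)) => -[].
Qed.

Lemma topology_join_nbhsl (x : X) :
  nbhs (x : tspace s) `<=` nbhs (x : tspace (topology_join s t)).
Proof.
have /topology_join_cvg[sx _] : nbhs (x : tspace (topology_join s t)) -->
  (x : tspace (topology_join s t)) by exact: cvg_id.
exact: sx.
Qed.

Lemma topology_join_nbhsr (x : X) :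
  nbhs (x : tspace t) `<=` nbhs (x : tspace (topology_join s t)).
Proof.
have /topology_join_cvg[_ tx] : nbhs (x : tspace (topology_join s t)) -->
  (x : tspace (topology_join s t)) by exact: cvg_id.
exact: tx.
Qed.

(** The sets containing some such intersection form a filter that converges to x
    in both topologies, hence in their supremum. *)
Lemma topology_join_nbhs (x : X) (W : set X) :
  nbhs (x : tspace (topology_join s t)) W ->
  exists U V, [/\ nbhs (x : tspace s) U, nbhs (x : tspace t) V &
    U `&` V `<=` W].
Proof.
pose F : set_system X := filter_from
  [set UV : set X * set X |
    nbhs (x : tspace s) UV.1 /\ nbhs (x : tspace t) UV.2]
  (fun UV => UV.1 `&` UV.2).
have FF : Filter F.
  apply: filter_from_filter.
    by exists (setT, setT); split; exact: filterT.
  move=> [U1 V1] [U2 V2] [/= nU1 nV1] [/= nU2 nV2].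
  exists (U1 `&` U2, V1 `&` V2); first by split; exact: filterI.
  by move=> y [[? ?] [? ?]].
have /(topology_join_cvg x FF) FW :
    F --> (x : tspace s) /\ F --> (x : tspace t).
  split=> U nU.
    by exists (U, setT); [split => //; exact: filterT|move=> y []].
  by exists (setT, U); [split => //; exact: filterT|move=> y []].
by move=> /FW [[U V] [/= nU nV] UVW]; exists U, V.
Qed.

End Join.

Section JoinAlgebra.

Lemma continuous_join1 (X : choiceType) (s t : Topological X) (f : X -> X) :
  continuous (f : tspace s -> tspace s) ->
  continuous (f : tspace t -> tspace t) ->
  continuous (f : tspace (topology_join s t) -> tspace (topology_join s t)).
Proof.
move=> fs ft x; set J := tspace (topology_join s t).
have Fx : Filter (f @ nbhs (x : J)) by exact: fmap_filter.
apply/(topology_join_cvg s t _ Fx); split=> W.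
  by move=> /(fs x)/(topology_join_nbhsl t).
by move=> /(ft x)/(topology_join_nbhsr s).
Qed.

Lemma continuous_join2 (X : choiceType) (s t : Topological X)
    (f : X -> X -> X) :
  continuous (fun z : tspace s * tspace s => f z.1 z.2 : tspace s) ->
  continuous (fun z : tspace t * tspace t => f z.1 z.2 : tspace t) ->
  continuous (fun z : tspace (topology_join s t) * tspace (topology_join s t) =>
    f z.1 z.2 : tspace (topology_join s t)).
Proof.
move=> fs ft [x y]; set J := tspace (topology_join s t).
have Fxy : Filter ((fun z => f z.1 z.2) @ nbhs ((x, y) : J * J)).
  exact: fmap_filter.
apply/(topology_join_cvg s t _ Fxy); split=> W.
  move=> /(fs (x, y))[[U V] [/= nU nV] UVW].
  by exists (U, V) => //; split; exact: topology_join_nbhsl.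
move=> /(ft (x, y))[[U V] [/= nU nV] UVW].
by exists (U, V) => //; split; exact: topology_join_nbhsr.
Qed.

Lemma topology_join_ring (X : pzRingType) (s t : Topological X) :
  ring_topology s -> ring_topology t -> ring_topology (topology_join s t).
Proof.
move=> [[sD sN] sM] [[tD tN] tM]; split; first split.
- exact: continuous_join2.
- exact: continuous_join1.
- exact: continuous_join2.
Qed.

End JoinAlgebra.

(** * Continuity of homomorphisms for the Bohr topology *)

Section InitialTopology.
Context {A B : zmodType} (f : {additive A -> B}) (t : Topological B).

Definition pullback_topology : Topological A :=
  Topological.on (initial_topology (f : A -> tspace t)).

Lemma pullback_topology_nbhs (x : A) (W : set A) :
  nbhs (x : tspace pullback_topology) W <->
  exists2 U, nbhs (f x : tspace t) U & f @^-1` U `<=` W.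
Proof.
split.
  rewrite nbhsE => -[_ [[U oU <-] Ux] UW].
  by exists U => //; exact: (@open_nbhs_nbhs (tspace t)).
move=> [U nU UW]; apply: filterS UW _.
exact: (@initial_continuous A (tspace t) f x U nU).
Qed.

Lemma pullback_topology_group :
  group_topology t -> group_topology pullback_topology.
Proof.
move=> [addc oppc]; split.
- move=> [x y] W /= /pullback_topology_nbhs[U]; rewrite raddfD => nU UW.
  have [[U1 U2] [/= n1 n2] U12] := addc (f x, f y) U nU.
  exists (f @^-1` U1, f @^-1` U2).
    by split; apply/pullback_topology_nbhs; [exists U1|exists U2].
  move=> [a b] [/= ? ?]; apply: UW; rewrite /= raddfD.
  exact: (U12 (f a, f b)).
- move=> x W /= /pullback_topology_nbhs[U]; rewrite raddfN => nU UW.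
  apply/pullback_topology_nbhs; exists (-%R @^-1` U); first exact: oppc.
  by move=> a /= Ua; apply: UW; rewrite /= raddfN.
Qed.

(** Covering by finitely many translates does not obviously pass to preimages,
    since the centres of the translates need not lie in the range. A finite
    colouring whose classes are V-small does: it can be composed with the
    homomorphism, and centres are then chosen inside the colour classes. *)
Lemma precompact_coloring (V : set B) :
  group_topology t -> precompact_topology t -> nbhs (0 : tspace t) V ->
  exists2 c : B -> B, finite_set (range c) & forall x y, c x = c y -> V (x - y).
Proof.
move=> [addc oppc] tp nV.
have /= := addc (0, 0) V; rewrite addr0 => /(_ nV)[[U1 U2] [/= n1 n2] U12].
have := oppc 0 U2; rewrite oppr0 => /(_ n2) nU2.
have [F fF FU] := tp _ (filterI n1 nU2).
have /choice[c Hc] : forall x, exists a, F a /\ (U1 `&` -%R @^-1` U2) (x - a).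
  by move=> x; have [a] := FU x; exists a.
exists c; first by apply: sub_finite_set fF => _ [x _ <-]; exact: (Hc x).1.
move=> x y cxy; have [_ [Ux _]] := Hc x; have [_ [_ Uy]] := Hc y.
have -> : x - y = (x - c x) + - (y - c y) by rewrite cxy opprB addrA subrK.
exact: (U12 (x - c x, - (y - c y))).
Qed.

Lemma pullback_topology_precompact :
  group_topology t -> precompact_topology t ->
  precompact_topology pullback_topology.
Proof.
move=> tg tp W /pullback_topology_nbhs[U]; rewrite raddf0 => nU UW.
have [c fc cU] := precompact_coloring tg tp nU.
pose r k := xget 0 [set x | c (f x) = k].
exists (r @` range c); first exact: finite_image.
move=> x; exists (r (c (f x))); first by exists (c (f x)) => //; exists (f x).
apply: UW; rewrite /= raddfB; apply: cU; apply/esym.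
exact: (@xgetPex _ 0 [set y | c (f y) = c (f x)] (ex_intro _ x erefl)).
Qed.

(** The pullback of t along f is one of the topologies over which the Bohr
    topology is maximal. *)
Lemma Bohr_topology_continuous (T : Topological A) : Bohr_topology T ->
  group_topology t -> precompact_topology t ->
  continuous (f : tspace T -> tspace t).
Proof.
move=> [_ _ Tmax] tg tp.
have sT := Tmax _ (pullback_topology_group tg)
  (pullback_topology_precompact tg tp).
by apply/continuousP => O oO; apply: sT; exists O.
Qed.

End InitialTopology.

(** * Subgroups and functionals of elementary abelian groups *)

Section ElementarySubgroups.
Context {A : zmodType} (p : nat) (p_prime : prime p).
Hypothesis pA0 : forall x : A, x *+ p = 0.
Implicit Types (H B K : set A) (x y e : A).

Let p_gt0 : (0 < p)%N. Proof. exact: prime_gt0. Qed.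

Lemma mulrn_modp x (k : nat) : x *+ (k %% p) = x *+ k.
Proof.
by rewrite [in RHS](divn_eq k p) mulrnDr mulnC mulrnA pA0 mul0rn add0r.
Qed.

Lemma mulrn_inv (k : nat) : ~~ (p %| k)%N ->
  exists u : nat, forall x, x *+ k *+ u = x.
Proof.
move=> pk; have /eqP cpk : coprime k p by rewrite coprime_sym prime_coprime.
have k_gt0 : (0 < k)%N by case: (k) pk => //; rewrite dvdn0.
have [u v uv _] := egcdnP p k_gt0; exists u => x.
by rewrite -mulrnA mulnC uv cpk mulrnDr mulnC mulrnA pA0 mul0rn add0r.
Qed.

Definition subgroup H := H 0 /\ forall x y, H x -> H y -> H (x - y).

(** The subgroup generated by H and x when H is a subgroup: natural multiples of
    x suffice because x has finite order. *)
Definition adjoin H x : set A := [set y | exists k : nat, H (y - x *+ k)].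

Lemma subgroupN H x : subgroup H -> H x -> H (- x).
Proof. by move=> [H0 HB] Hx; rewrite -[- x]add0r; exact: HB. Qed.

Lemma subgroupD H x y : subgroup H -> H x -> H y -> H (x + y).
Proof.
by move=> Hg Hx Hy; rewrite -[y]opprK; apply: Hg.2 => //; exact: subgroupN.
Qed.

Lemma subgroupMn H x k : subgroup H -> H x -> H (x *+ k).
Proof.
move=> Hg Hx; elim: k => [|k IH]; first by rewrite mulr0n; exact: Hg.1.
by rewrite mulrS; exact: subgroupD.
Qed.

Lemma sub_adjoin H x : H `<=` adjoin H x.
Proof. by move=> y Hy; exists 0%N; rewrite mulr0n subr0. Qed.

Lemma adjoin_mem H x : subgroup H -> adjoin H x x.
Proof. by move=> Hg; exists 1%N; rewrite mulr1n subrr; exact: Hg.1. Qed.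

Lemma subgroup_adjoin H x : subgroup H -> subgroup (adjoin H x).
Proof.
move=> Hg; split; first exact/sub_adjoin/Hg.1.
move=> y z [k Hy] [l Hz]; exists (k + l * p.-1)%N.
have -> : y - z - x *+ (k + l * p.-1) = (y - x *+ k) - (z - x *+ l).
  have xl : x *+ l *+ p.-1 = - (x *+ l).
    by apply/eqP; rewrite -addr_eq0 -mulrSr prednK// pA0.
  by rewrite mulrnDr mulrnA xl [in RHS]opprB opprD opprK addrACA [- z + _]addrC.
exact: Hg.2.
Qed.

(** If e = h + k (a - e) with k prime to p, then a is a combination of h and e;
    if p divides k, then e = h. *)
Lemma adjoin_sub_notin H e a : subgroup H -> ~ H e -> ~ adjoin H e a ->
  ~ adjoin H (a - e) e.
Proof.
move=> Hg He Ha [k Hk]; have [/dvdnP[m km]|pk] := boolP (p %| k)%N.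
  by apply: He; move: Hk; rewrite km mulnC mulrnA pA0 mul0rn subr0.
have [u ku] := mulrn_inv pk; apply: Ha; exists u.+1.
have -> : a - e *+ u.+1 = - ((e - (a - e) *+ k) *+ u).
  by rewrite (mulrnBl _ e) ku [RHS]opprB mulrS opprD addrA.
by apply: (subgroupN Hg); exact: subgroupMn.
Qed.

Lemma finite_adjoin H x : finite_set H -> finite_set (adjoin H x).
Proof.
move=> fH.
apply: sub_finite_set (finite_image (fun z => z.1 + x *+ z.2)
  (finite_setX fH (finite_II p))) => y [k Hy].
exists (y - x *+ k, (k %% p)%N) => /=; last by rewrite mulrn_modp subrK.
by split => //=; rewrite ltn_pmod.
Qed.

Lemma finite_subgroup_exists K : finite_set K ->
  exists B, [/\ finite_set B, subgroup B & K `<=` B].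
Proof.
move=> /finite_seqP[s ->]; elim: s => [|x s [B [fB Bg sB]]].
  exists [set 0]; split; first exact: finite_set1.
    by split => // x y -> ->; rewrite /= subr0.
  by move=> x.
exists (adjoin B x); split.
- exact: finite_adjoin fB.
- exact: subgroup_adjoin Bg.
- move=> y /=; rewrite inE => /orP[/eqP->|ys]; first exact: adjoin_mem.
  exact/sub_adjoin/sB.
Qed.

Lemma maximal_subgroup_avoiding B e : subgroup B -> ~ B e ->
  exists H, [/\ subgroup H, B `<=` H, ~ H e &
    forall H', subgroup H' -> H `<=` H' -> ~ H' e -> H' `<=` H].
Proof.
move=> Bg Be.
(* The empty set is admitted in P to accommodate the empty chain. *)
pose P := [set H | H = set0 \/ [/\ subgroup H, B `<=` H & ~ H e]].
have [H [PH Hmax]] : exists H, P H /\ forall H', H `<` H' -> ~ P H'.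
  apply: Zorn_bigcup => F FP Ftot.
  have [[H0 FH0 H00]|F0] := pselect (exists2 H, F H & H !=set0); last first.
    left; rewrite -subset0 => x [H FH Hx]; apply: F0.
    by exists H => //; exists x.
  have FP' H x : F H -> H x -> [/\ subgroup H, B `<=` H & ~ H e].
    by move=> FH Hx; have [H_0|//] := FP _ FH; rewrite H_0 in Hx.
  have [x0 H0x0] := H00; have [H0g BH0 _] := FP' _ _ FH0 H0x0.
  right; split.
  - split; first by exists H0 => //; exact: H0g.1.
    move=> x y [H1 F1 H1x] [H2 F2 H2y].
    have [H1g _ _] := FP' _ _ F1 H1x; have [H2g _ _] := FP' _ _ F2 H2y.
    have [H12|H21] := Ftot _ _ F1 F2.
      by exists H2 => //; apply: H2g.2 => //; exact: H12.
    by exists H1 => //; apply: H1g.2 => //; exact: H21.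
  - by move=> b Bb; exists H0 => //; exact: BH0.
  - by move=> [H FH He]; have [] := FP' _ _ FH He.
have PB : P B by right; split.
have H0 : H !=set0.
  apply/set0P/negP => /eqP H0; apply: (Hmax B) => //.
  by rewrite H0 properEneq; split => //; apply/eqP => B0; case: Bg; rewrite -B0.
case: PH => [H_0|[Hg BH He]]; first by case: H0 => x; rewrite H_0.
exists H; split => // H' H'g HH' H'e; apply: contrapT => nH'H.
by apply: (Hmax H') => //; right; split => // b /BH /HH'.
Qed.

(** A subgroup H maximal among those containing B and avoiding e is the kernel
    sought: for x outside H, maximality puts e in H + <x>, so that x lies in
    H + <e>. Hence e generates the quotient of A by H, which has order p. *)
Lemma functional_exists (B : set A) (e : A) : subgroup B -> ~ B e ->
  exists phi : {additive A -> 'F_p}, phi e = 1 /\ forall x, B x -> phi x = 0.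
Proof.
move=> Bg Be; have [H [Hg BH He Hmax]] := maximal_subgroup_avoiding Bg Be.
have Hek (k : nat) : H (e *+ k) -> (p %| k)%N.
  move=> Hk; apply: contrapT => /negP pk; apply: He.
  have [u /(_ e) <-] := mulrn_inv pk.
  exact: subgroupMn.
have /choice[c Hc] x : exists k : nat, H (x - e *+ k).
  have [Hx|nHx] := pselect (H x); first by exists 0%N; rewrite subr0.
  have adj_e : adjoin H x e.
    apply: contrapT => ne; apply: nHx.
    apply: (Hmax (adjoin H x)) => //; last exact: adjoin_mem.
      exact: subgroup_adjoin.
    exact: sub_adjoin.
  have [k Hk] := adj_e.
  have pk : ~~ (p %| k)%N.
    apply/negP => /dvdnP[m km]; apply: He.
    by move: Hk; rewrite km mulnC mulrnA pA0 mul0rn subr0.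
  have [u ku] := mulrn_inv pk; exists u.
  have -> : x - e *+ u = - ((e - x *+ k) *+ u) by rewrite mulrnBl ku opprB.
  by apply: (subgroupN Hg); exact: subgroupMn.
have uniq_mod x k l : H (x - e *+ k) -> H (x - e *+ l) -> k%:R = l%:R :> 'F_p.
  move=> Hk Hl; wlog kl : k l Hk Hl / (k <= l)%N => [th|].
    by have [kl|/ltnW lk] := leqP k l; [exact: th|apply/esym/th].
  have := Hg.2 _ _ Hk Hl.
  rewrite opprB addrC addrA subrK -mulrnBr// => /Hek; rewrite -eqn_mod_dvd//.
  by move=> /eqP lk; rewrite -(Fp_nat_mod p_prime k) -lk Fp_nat_mod.
have phi_add : zmod_morphism (fun x => (c x)%:R : 'F_p).
  move=> x y /=; apply/eqP; rewrite eq_sym subr_eq -natrD; apply/eqP/esym.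
  apply: (uniq_mod x) => //; rewrite mulrnDr opprD addrA.
  have -> : x - e *+ c (x - y) - e *+ c y =
      (x - y - e *+ c (x - y)) + (y - e *+ c y).
    by rewrite addrA [x - y - _]addrAC subrK.
  exact: subgroupD.
pose phi : {additive A -> 'F_p} := HB.pack (fun x => (c x)%:R : 'F_p)
  (GRing.isZmodMorphism.Build _ _ _ phi_add).
exists phi; split.
  by apply: (uniq_mod e _ 1%N) => //; rewrite mulr1n subrr; exact: Hg.1.
by move=> x Bx; apply: (uniq_mod x _ 0%N) => //; rewrite subr0; exact: BH.
Qed.

End ElementarySubgroups.

(** * The Bohr topology has no countable base at zero *)

(** A finite group is precompact for its discrete topology, here presented as
    the translation-invariant topology of the principal filter at zero. *)
Lemma Bohr_topology_kernel (A B : zmodType) (T : Topological A)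
    (f : {additive A -> B}) : Bohr_topology T -> finite_set [set: B] ->
  nbhs (0 : tspace T) [set x | f x = 0].
Proof.
move=> TB finB.
pose t := shift_topology (globally_filter [set (0 : B)]).
have nbhs_t b (W : set B) : nbhs (b : tspace t) W <-> W b.
  rewrite shift_topology_nbhs => [|V|V FV]; last 2 first.
  - exact.
  - by exists [set 0] => // x y -> ->; rewrite addr0; exact: FV.
  by split=> [/(_ _ erefl)/=|Wb _ -> /=]; rewrite add0r.
have tg : group_topology t.
  apply: shift_topology_group => [V|V FV|V FV].
  - exact.
  - by exists [set 0] => // x y -> ->; rewrite addr0; exact: FV.
  - by move=> _ -> /=; rewrite oppr0; exact: FV.
have tp : precompact_topology t.
  move=> V /nbhs_t V0; exists setT => // x; exists x => //.
  by rewrite subrr.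
have fc := Bohr_topology_continuous TB tg tp (f := f).
by apply: (fc 0 [set 0]); apply/nbhs_t; rewrite /= raddf0.
Qed.

Lemma precompact_nbhs0_infinite (A : zmodType) (t : Topological A) (V : set A) :
  precompact_topology t -> infinite_set [set: A] -> nbhs (0 : tspace t) V ->
  infinite_set V.
Proof.
move=> tp infA /tp[F fF FV] finV; apply: infA.
apply: sub_finite_set (finite_image (fun z => z.1 + z.2) (finite_setX fF finV)).
move=> x _; have [a Fa Va] := FV x; exists (a, x - a) => //=.
by rewrite addrC subrK.
Qed.

Lemma infinite_setDn (X : Type) (V B : set X) :
  infinite_set V -> finite_set B -> exists2 a, V a & ~ B a.
Proof.
move=> infV finB; apply: contrapT => nB; apply: infV.
apply: sub_finite_set finB => a Va; apply: contrapT => nBa.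
by apply: nB; exists a.
Qed.

Section ElementaryGroup.
Context {A : zmodType} (p : nat) (p_prime : prime p).
Hypothesis pA0 : forall x : A, x *+ p = 0.
Hypothesis A_infinite : infinite_set [set: A].

(** Fix e <> 0 and build an increasing chain of finite subgroups B_n avoiding e,
    where B_(n+1) is generated by B_n and a_n - e for some a_n in W_n outside
    B_n + <e>. A functional with value 1 at e that vanishes on the union of the
    chain takes the value 1 at every a_n. *)
Lemma functional_separating (W : nat -> set A) :
  (forall n, infinite_set (W n)) ->
  exists phi : {additive A -> 'F_p}, forall n, exists2 a, W n a & phi a != 0.
Proof.
move=> Winf.
have [e _ e0] := infinite_setDn A_infinite (finite_set1 0).
(* The choice of a_n depends on the subgroup B_n already built. *)
have /choice[a Ha] (nB : nat * set A) :
    exists a, finite_set nB.2 -> W nB.1 a /\ ~ adjoin nB.2 e a.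
  have [fB|nf] := pselect (finite_set nB.2); last by exists 0.
  have [a Wa Ba] :=
    infinite_setDn (Winf nB.1) (finite_adjoin p_prime pA0 e fB).
  by exists a.
pose B := fix B n :=
  if n is m.+1 then adjoin (B m) (a (m, B m) - e) else [set 0].
have B_ok n : [/\ finite_set (B n), subgroup (B n) & ~ B n e].
  elim: n => [|n [fB Bg Be]] /=.
    split=> //.
    by split=> // x y -> ->; rewrite /= subr0.
  have [Wa nBa] := Ha (n, B n) fB; split.
  - exact: (finite_adjoin p_prime pA0).
  - exact: (subgroup_adjoin p_prime pA0).
  - exact: (adjoin_sub_notin p_prime pA0).
have B_mono m n : (m <= n)%N -> B m `<=` B n.
  elim: n => [|n IH]; first by rewrite leqn0 => /eqP->.
  rewrite leq_eqVlt => /orP[/eqP->//|mn] x /(IH mn); exact: sub_adjoin.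
have [phi [phie phiB]] : exists phi : {additive A -> 'F_p},
    phi e = 1 /\ forall x, (\bigcup_n B n) x -> phi x = 0.
  apply: (functional_exists p_prime pA0); last first.
    by move=> [n _]; have [] := B_ok n.
  split; first by exists 0%N.
  move=> x y [m _ Bx] [n _ By]; exists (maxn m n) => //.
  have [_ Bg _] := B_ok (maxn m n).
  apply: Bg.2; first by apply: B_mono Bx; exact: leq_maxl.
  by apply: B_mono By; exact: leq_maxr.
exists phi => n; have [fB Bg _] := B_ok n.
exists (a (n, B n)); first by have [] := Ha (n, B n) fB.
have /phiB : (\bigcup_n B n) (a (n, B n) - e).
  by exists n.+1 => //=; exact: adjoin_mem.
by rewrite raddfB phie => /eqP; rewrite subr_eq0 => /eqP->; rewrite oner_neq0.
Qed.

Lemma Bohr_topology_no_countable_base (T : Topological A)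
    (W : nat -> set A) :
  Bohr_topology T -> (forall n, nbhs (0 : tspace T) (W n)) ->
  exists2 V, nbhs (0 : tspace T) V & forall n, ~ W n `<=` V.
Proof.
move=> TB nW; have [_ Tp _] := TB.
have [phi phiW] := functional_separating
  (fun n => precompact_nbhs0_infinite Tp A_infinite (nW n)).
exists [set x | phi x = 0].
  by apply: Bohr_topology_kernel TB _; exact: finite_finset.
by move=> n WV; have [a Wa /eqP] := phiW n; apply; exact: WV.
Qed.

(** * Rank-one endomorphisms *)

Lemma rank_one_endomorphism (phi : {additive A -> 'F_p}) (a : A) :
  exists f : End A, forall x, f x = a *+ phi x.
Proof.
have valD (u v : 'F_p) : (u + v)%R = ((u + v) %% p)%N :> nat.
  by rewrite /=; congr (_ %% _)%N; exact: Fp_cast.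
have h_add : zmod_morphism (fun x => a *+ phi x).
  move=> x y /=; apply/eqP; rewrite eq_sym subr_eq; apply/eqP/esym.
  by rewrite -mulrnDr -[LHS](mulrn_modp pA0) -valD -raddfD subrK.
pose f : {additive A -> A} := HB.pack (fun x => a *+ phi x)
  (GRing.isZmodMorphism.Build _ _ _ h_add).
by exists f.
Qed.

(** The finite subgroup spanned by K cannot be all of A; a functional vanishing
    on it and equal to 1 at a point e outside it yields the endomorphisms. *)
Lemma End_transitive_modulo_finite (K : set A) : finite_set K ->
  exists e, forall a, exists f : End A,
    [/\ End_kill K f, f e = a & forall x, exists k : nat, f x = a *+ k].
Proof.
move=> /(finite_subgroup_exists p_prime pA0)[B [fB Bg KB]].
have [e _ nBe] := infinite_setDn A_infinite fB.
have [phi [phie phiB]] := functional_exists p_prime pA0 Bg nBe.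
exists e => a; have [f fE] := rank_one_endomorphism phi a; exists f; split.
- by move=> x /KB /phiB phix; rewrite fE phix mulr0n.
- by rewrite fE phie mulr1n.
- by move=> x; exists (phi x); rewrite fE.
Qed.

End ElementaryGroup.

(** * Nonmetrizability of the supremum *)

Lemma metrizable_nbhs_base (R : realType) (X : Type) (t : Topological X)
    (x : X) : metrizable R t ->
  exists2 N : nat -> set X, (forall n, nbhs (x : tspace t) (N n)) &
    forall W, nbhs (x : tspace t) W -> exists n, N n `<=` W.
Proof.
move=> [d dt]; pose M := Metric.Pack d.
have nbhs_eq : nbhs (x : tspace t) = nbhs (x : M).
  by rewrite (@nbhsE (tspace t)) (@nbhsE M) /open_nbhs dt.
exists (fun n => ball (x : M) n.+1%:R^-1).
  by move=> n; rewrite nbhs_eq; exact: nbhsx_ballx.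
move=> W; rewrite nbhs_eq => /nbhs_ballP[r /= r0 rW].
have [n nr] := ltr_add_invr r0.
exists n => y xy; apply: rW; apply: le_ball xy; rewrite ltW//.
by move: nr; rewrite add0r.
Qed.

Lemma nbhs0_multiples (A : zmodType) (t : Topological A) (V : set A) (p : nat) :
  group_topology t -> nbhs (0 : tspace t) V ->
  nbhs (0 : tspace t) [set a | forall k, (k < p)%N -> V (a *+ k)].
Proof.
move=> [addc _] nV; have mulc k U : nbhs (0 : tspace t) U ->
    nbhs (0 : tspace t) [set a | U (a *+ k)].
  elim: k U => [|k IH] U nU.
    apply: filterS filterT => a _; rewrite /= mulr0n.
    exact: (@nbhs_singleton (tspace t)).
  have /= := addc (0, 0) U; rewrite addr0 => /(_ nU)[[U1 U2] [/= n1 n2] U12].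
  apply: filterS (filterI n1 (IH _ n2)) => a [U1a U2a] /=; rewrite mulrS.
  exact: (U12 (a, a *+ k)).
have : nbhs (0 : tspace t) [set a | forall k : 'I_p, V (a *+ k)].
  by apply: (filter_forall (nbhs_filter (0 : tspace t))) => k; exact: mulc.
by apply: filterS => a Va k kp; exact: (Va (Ordinal kp)).
Qed.

Theorem theorem7 (R : realType) (p : nat) (A : zmodType) (T : Topological A)
    (p_prime : prime p) (pA0 : forall x : A, x *+ p = 0)
    (A_countable : countable [set: A]) (A_infinite : infinite_set [set: A])
    (T_Bohr : Bohr_topology T) :
  let S := topology_join (associated_topology T) (finite_topology A) in
  admissible S /\ ~ metrizable R S.
Proof.
move=> S; have [Tg Tp _] := T_Bohr; split.
  split; last first.
    move=> U; rewrite !openE => oU f /oU; exact: topology_join_nbhsr.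
  apply: topology_join_ring; last exact: finite_topology_ring.
  apply: associated_topology_ring => // f.
  exact: (@Bohr_topology_continuous A A f T T T_Bohr Tg Tp).
move=> /(metrizable_nbhs_base 0)[N nN Nbase].
have /choice[VK HVK] n : exists VK : set A * set A,
    [/\ nbhs (0 : tspace T) VK.1, finite_set VK.2 &
        End_into VK.1 `&` End_kill VK.2 `<=` N n].
  have [P [Q [+ + PQN]]] := topology_join_nbhs (nN n).
  rewrite associated_topology_nbhs0// finite_topology_nbhs0.
  move=> [V nV VP] [K fK KQ]; exists (V, K); split => // f [/VP Pf /KQ Qf].
  exact: PQN.
(* V_n need not be a subgroup, and an endomorphism with a in its range also
   takes the multiples of a as values; W_n demands that they all lie in V_n. *)
pose W n := [set a : A | forall k, (k < p)%N -> (VK n).1 (a *+ k)].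
have nW n : nbhs (0 : tspace T) (W n).
  by have [nV _ _] := HVK n; exact: nbhs0_multiples.
have [V nV WV] :=
  Bohr_topology_no_countable_base p_prime pA0 A_infinite T_Bohr nW.
have [n NV] : exists n, N n `<=` End_into V.
  apply: Nbase; apply: topology_join_nbhsl.
  by rewrite associated_topology_nbhs0//; exists V.
apply: (WV n) => a Wa; have [_ fK VKN] := HVK n.
have [e /(_ a)[f [fK0 fe fa]]] :=
  End_transitive_modulo_finite p_prime pA0 A_infinite fK.
have /VKN/NV : (End_into (VK n).1 `&` End_kill (VK n).2) f.
  split=> // _ [x _ <-]; have [k ->] := fa x.
  by rewrite -(mulrn_modp pA0); apply: Wa; rewrite ltn_pmod// prime_gt0.
by apply; exists e.
Qed.
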